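(* Let $A\in\mathbb{R}^{n\times n}$ and $B\in\mathbb{R}^{n\times m}$ (with $1\le m<n$) be of the form $$A=\begin{bmatrix} A_{11} & A_{12} \\ A_{21} & A_{22} \end{bmatrix},\quad A_{11}\in\mathbb{R}^{m\times m},\qquad B=\begin{bmatrix} I_m \\ 0 \end{bmatrix}.$$ Let $\mathcal{R}(A,B)$ and $\mathcal{R}(A_{22},A_{21})$ denote the controllability matrices of the pairs $(A,B)$ and $(A_{22},A_{21})$. Then for every $\mathbf{v}_1\in\mathbb{R}^m$ and every $\mathbf{v}_2\in\mathbb{R}^{n-m}$, $$\begin{bmatrix} \mathbf{v}_1 \\ \mathbf{v}_2 \end{bmatrix}\in\mathrm{Im}(\mathcal{R}(A,B))\iff \mathbf{v}_2\in\mathrm{Im}(\mathcal{R}(A_{22},A_{21})).$$ Therefore the pair $(A,B)$ is herdable if and only if the pair $(A_{22},A_{21})$ is herdable.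
   Context: For $F\in\mathbb{R}^{p\times p}$ and $G\in\mathbb{R}^{p\times q}$, the controllability matrix of the pair $(F,G)$ is $\mathcal{R}(F,G)=[\,G\;|\;FG\;|\;F^2G\;|\;\cdots\;|\;F^{p-1}G\,]$, and $\mathrm{Im}$ denotes the image (column space) of a matrix. Herdability: the pair $(F,G)$ describes the linear time-invariant system $\dot{\mathbf{x}}(t)=F\mathbf{x}(t)+G\mathbf{u}(t)$ (or its discrete-time counterpart $\mathbf{x}(t+1)=F\mathbf{x}(t)+G\mathbf{u}(t)$). The pair is (completely) herdable if for every $\mathbf{x}(0)$ and every $h>0$ there exist a time $t_f>0$ and an input $\mathbf{u}(t)$, $t\in[0,t_f)$, driving the state from $\mathbf{x}(0)$ to some $\mathbf{x}(t_f)\ge h\mathbf{1}_p$ (entrywise, $\mathbf{1}_p$ the all-ones vector). It is known that (in both continuous and discrete time) this is equivalent to $\mathrm{Im}(\mathcal{R}(F,G))$ containing a vector all of whose entries are positive. *)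

(* Defs.v *)
From mathcomp Require Export all_boot all_order all_algebra.
From mathcomp Require Export all_classical all_reals all_analysis.
Export Order.TTheory GRing.Theory Num.Theory.
Export numFieldNormedType.Exports.

Set Implicit Arguments.
Unset Strict Implicit.
Unset Printing Implicit Defensive.

Local Open Scope classical_set_scope.
Local Open Scope ring_scope.

(** [G | F G | ... | F^(p-1) G] *)
Definition ctrlmx (R : realType) (p q : nat) (F : 'M[R]_p) (G : 'M[R]_(p, q)) :
    'M[R]_(p, \sum_(j < p) q) :=
  \mxrow_(j < p) (F ^+ j *m G).

Definition in_image (R : realType) (p r : nat) (M : 'M[R]_(p, r))
    (v : 'cV[R]_p) : Prop :=
  exists w : 'cV[R]_r, v = M *m w.

(** Solution of x' = F x + G u on [0, tf] in the sense of Caratheodory: the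
    input is Lebesgue integrable on [0, tf[, the state is continuous and
    x(t) = x(0) + \int_0^t (F x(s) + G u(s)) ds.  All conditions are stated
    entrywise; integrability of u and continuity of x make the real-valued
    integral meaningful. *)
Definition ct_trajectory (R : realType) (p q : nat) (F : 'M[R]_p)
    (G : 'M[R]_(p, q)) (tf : R) (u : R -> 'cV[R]_q) (x : R -> 'cV[R]_p) : Prop :=
  [/\ forall j : 'I_q, (@lebesgue_measure R).-integrable `[0, tf[
        (fun s => (u s j 0)%:E),
      forall i : 'I_p, {within `[0, tf], continuous (fun s => x s i 0)} &
      forall t : R, 0 <= t <= tf -> forall i : 'I_p,
        x t i 0 = x 0 i 0 +
          Rintegral (@lebesgue_measure R) `[0, t[
            (fun s => (F *m x s + G *m u s) i 0)].

Definition ct_herdable (R : realType) (p q : nat) (F : 'M[R]_p)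
    (G : 'M[R]_(p, q)) : Prop :=
  forall (x0 : 'cV[R]_p) (h : R), 0 < h ->
  exists (tf : R) (u : R -> 'cV[R]_q) (x : R -> 'cV[R]_p),
    [/\ 0 < tf, ct_trajectory F G tf u x, x 0 = x0 &
        forall i : 'I_p, h <= x tf i 0].

Definition dt_trajectory (R : realType) (p q : nat) (F : 'M[R]_p)
    (G : 'M[R]_(p, q)) (tf : nat) (u : nat -> 'cV[R]_q)
    (x : nat -> 'cV[R]_p) : Prop :=
  forall t : nat, (t < tf)%N -> x t.+1 = F *m x t + G *m u t.

Definition dt_herdable (R : realType) (p q : nat) (F : 'M[R]_p)
    (G : 'M[R]_(p, q)) : Prop :=
  forall (x0 : 'cV[R]_p) (h : R), 0 < h ->
  exists (tf : nat) (u : nat -> 'cV[R]_q) (x : nat -> 'cV[R]_p),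
    [/\ (0 < tf)%N, dt_trajectory F G tf u x, x 0%N = x0 &
        forall i : 'I_p, h <= x tf i 0].

(* Main.v *)
Require Import Defs.
From mathcomp Require Import zify ring.

(** The image of the controllability matrix of [(F, G)] is the smallest
    [F]-invariant subspace that contains the image of [G]: Cayley-Hamilton gives
    the invariance ([in_ctrlmx_state]), the minimality is an induction
    ([ctrl_ind]).  When the input matrix is the inclusion of the first block,
    this subspace contains every vector supported on that block, so only the
    lower block of a vector matters; the first block then acts on the second
    as a free input through [A21], while [A22] propagates.  Both inclusions of
    [in_ctrlmx_block] follow from this.

    In discrete and in continuous time, a pair is herdable if and only if the
    image of its controllability matrix contains a positive vector
    ([dt_herdableP], [ct_herdableP]).  The equivalence of the two herdability
    properties follows: the lower block of a positive vector is positive, and a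
    positive lower block can be completed by ones.

    In discrete time the characterisation is the variation of constants
    formula.  In continuous time it has two halves.

    Every state reached from 0 lies in the image ([ct_reach_ctrl]).  The linear
    forms that annihilate the image kill the input and satisfy an autonomous
    linear equation along a trajectory; they start at 0, hence stay at 0.
    Uniqueness comes from pairing with a solution of the adjoint equation
    ([linear_flow_unique]), and solutions are power series
    ([linear_flow_exists]).

    Every vector of the image is reached from 0 at time 1 ([steerable_ctrl]),
    by a polynomial trajectory.  Applying the adjugate of [d/dt - F] to a scalar
    polynomial [psi] times [G w] gives a trajectory ([flat_trajectory]), whose
    end points are determined by the derivatives of [psi] at times 0 and 1;
    products of powers of [X] and [X - 1] realise enough of these. *)

Set Implicit Arguments.
Unset Strict Implicit.
Unset Printing Implicit Defensive.

Local Open Scope classical_set_scope.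
Local Open Scope ring_scope.

(** * The image of the controllability matrix *)

Lemma mx_exprS (R : realType) p (F : 'M[R]_p) j : F ^+ j.+1 = F *m F ^+ j.
Proof. by rewrite exprS. Qed.

Lemma mx_exprSr (R : realType) p (F : 'M[R]_p) j : F ^+ j.+1 = F ^+ j *m F.
Proof. by rewrite exprSr. Qed.

Lemma in_ctrlmxP (R : realType) p q (F : 'M[R]_p) (G : 'M[R]_(p, q))
    (v : 'cV[R]_p) :
  in_image (ctrlmx F G) v <->
  exists w : 'I_p -> 'cV[R]_q, v = \sum_(j < p) F ^+ j *m (G *m w j).
Proof.
split=> [[w ->]|[w ->]].
  exists (fun j => submxcol w j); rewrite -{1}[w]submxcolK mul_mxrow_mxcol.
  by apply: eq_bigr => j _; rewrite mulmxA.
exists (\mxcol_j w j); rewrite mul_mxrow_mxcol.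
by apply: eq_bigr => j _; rewrite mulmxA.
Qed.

Section Image.
Context (R : realType) (p r : nat) (M : 'M[R]_(p, r)).

Lemma in_image0 : in_image M 0.
Proof. by exists 0; rewrite mulmx0. Qed.

Lemma in_imageD v w : in_image M v -> in_image M w -> in_image M (v + w).
Proof. by move=> [a ->] [b ->]; exists (a + b); rewrite mulmxDr. Qed.

Lemma in_imageZ c v : in_image M v -> in_image M (c *: v).
Proof. by move=> [a ->]; exists (c *: a); rewrite scalemxAr. Qed.

Lemma in_image_sum (I : Type) (s : seq I) (P : pred I) (f : I -> 'cV[R]_p) :
  (forall i, P i -> in_image M (f i)) -> in_image M (\sum_(i <- s | P i) f i).
Proof.
by move=> Pf; apply: big_ind => //; [exact: in_image0|exact: in_imageD].
Qed.

(** The image of [M] is cut out by the linear forms that vanish on it.  The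
    cokernel matrix of the transpose detects membership, and its rows lie in
    the row space of [kermx M]. *)
Lemma in_image_kermx (v : 'cV[R]_p) : in_image M v <-> kermx M *m v = 0.
Proof.
split=> [[w ->]|Kv]; first by rewrite mulmxA mulmx_ker mul0mx.
have : ((cokermx M^T)^T <= kermx M)%MS.
  by apply/sub_kermxP; rewrite -[M]trmxK -trmx_mul trmxK mulmx_coker trmx0.
case/submxP => E EK.
have : (v^T <= M^T)%MS.
  by rewrite submxE -[_ *m _]trmxK trmx_mul trmxK EK -mulmxA Kv mulmx0 trmx0.
by case/submxP => w vw; exists w^T; rewrite -[v]trmxK vw trmx_mul trmxK.
Qed.
End Image.

Section Ctrl.
Context (R : realType) (p : nat) (F : 'M[R]_p).

(** Cayley-Hamilton, solved for the leading power. At size 0 all matrices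
    are equal and the empty sum will do. *)
Lemma expmx_combination :
  exists c : nat -> R, F ^+ p = \sum_(i < p) c i *: F ^+ i.
Proof.
case: p F => [|n] A; first by exists (fun=> 0); apply/matrixP => -[].
exists (fun i => - (char_poly A)`_i).
have := Cayley_Hamilton A; have mA := char_poly_monic A.
rewrite -[in X in X -> _](coefK (char_poly A)) poly_def size_char_poly.
rewrite big_ord_recr /= linearD linearZ /= linear_sum /= rmorphXn /= horner_mx_X.
have -> : (char_poly A)`_n.+1 = 1.
  by have /monicP := mA; rewrite lead_coefE size_char_poly.
rewrite scale1r addrC => /eqP; rewrite addr_eq0 => /eqP ->.
rewrite -sumrN; apply: eq_bigr => i _.
by rewrite linearZ /= rmorphXn /= horner_mx_X scaleNr.
Qed.

(** The matrices [e j] are the successive stages of the Horner evaluation of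
    the characteristic polynomial at [F], so that [e p = 0] is Cayley-Hamilton.
    They are the coefficients of the adjugate of ['X - F]: the recurrence is
    what makes the polynomial steering of [flat_trajectory] close up. *)
Lemma horner_scheme :
  exists (d : nat -> R) (e : nat -> 'M[R]_p),
  [/\ e 0%N = 1%:M, forall j, e j.+1 = F *m e j - (d j)%:M & e p = 0].
Proof.
have [c cE] := expmx_combination.
(* Horner evaluation consumes the coefficients from the highest one down. *)
pose d j := c (p - j.+1)%N.
pose e := fix e j := if j is k.+1 then F *m e k - (d k)%:M else 1%:M.
exists d, e; split => //.
have eE j : e j = F ^+ j - \sum_(i < j) d (j - i.+1)%N *: F ^+ i.
  elim: j => [|j IH] /=; first by rewrite big_ord0 subr0 expr0.
  rewrite IH mulmxBr mulmx_sumr -mx_exprS big_ord_recl expr0 subn1 /=.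
  rewrite -scalemx1 opprD -addrA [- _ - _]addrC; congr (_ + (_ - _)); congr -%R.
  apply: eq_bigr => i _.
  by rewrite -scalemxAr -mx_exprS /bump /= add1n subSS.
rewrite eE cE; apply/eqP; rewrite subr_eq0; apply/eqP.
apply: eq_bigr => i _; rewrite /d; congr (c _ *: _).
by have := ltn_ord i; lia.
Qed.

Context (q : nat) (G : 'M[R]_(p, q)).

(** The image of the controllability matrix is the smallest [F]-invariant
    subspace that contains the image of [G].  This lemma is the minimality;
    [in_ctrlmx_input] and [in_ctrlmx_state] say that it is such a subspace. *)
Lemma ctrl_ind (P : 'cV[R]_p -> Prop) :
  P 0 -> (forall v w, P v -> P w -> P (v + w)) ->
  (forall w, P (G *m w)) -> (forall v, P v -> P (F *m v)) ->
  forall v, in_image (ctrlmx F G) v -> P v.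
Proof.
move=> P0 PD PG PF v /in_ctrlmxP[w ->]; apply: big_ind => // j _.
elim: (nat_of_ord j) => [|i IH]; first by rewrite expr0 mul1mx.
by rewrite mx_exprS -mulmxA; exact: PF.
Qed.

Lemma in_ctrlmx_gen j w : (j < p)%N ->
  in_image (ctrlmx F G) (F ^+ j *m (G *m w)).
Proof.
move=> jp; apply/in_ctrlmxP.
exists (fun i => if i == Ordinal jp then w else 0).
rewrite (bigD1 (Ordinal jp)) //= eqxx big1 ?addr0// => i /negbTE ->.
by rewrite !mulmx0.
Qed.

Lemma in_ctrlmx_input w : in_image (ctrlmx F G) (G *m w).
Proof.
case: (posnP p) => [p0|p0]; last first.
  by have := in_ctrlmx_gen w p0; rewrite expr0 mul1mx.
suff -> : G *m w = 0 by exact: in_image0.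
by apply/matrixP => i; have := ltn_ord i; rewrite {2}p0.
Qed.

(** Only the last block leaves the range of the exponents, and Cayley-Hamilton
    brings it back. *)
Lemma in_ctrlmx_state v :
  in_image (ctrlmx F G) v -> in_image (ctrlmx F G) (F *m v).
Proof.
move=> /in_ctrlmxP[w ->]; rewrite mulmx_sumr; apply: in_image_sum => j _.
rewrite mulmxA -mx_exprS.
have := ltn_ord j; rewrite leq_eqVlt => /predU1P[->|]; last exact: in_ctrlmx_gen.
have [c ->] := expmx_combination.
rewrite mulmx_suml; apply: in_image_sum => i _.
by rewrite -scalemxAl; apply/in_imageZ/in_ctrlmx_gen.
Qed.

Lemma in_ctrlmx_exp j w : in_image (ctrlmx F G) (F ^+ j *m (G *m w)).
Proof.
elim: j => [|j IH]; first by rewrite expr0 mul1mx; exact: in_ctrlmx_input.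
by rewrite mx_exprS -mulmxA; exact: in_ctrlmx_state.
Qed.

End Ctrl.

(** * Systems whose input acts directly on the first block *)

(** Since the input drives the first block directly, vectors of the form
    [col_mx w 0] are free on both sides.  Left to right, the vectors whose lower
    part is reachable for [(A22, A21)] form an invariant subspace that contains
    the image of [B].  Right to left, once the upper part has been cancelled by
    the input, multiplying by the block matrix acts on the lower part as [A21]
    on [col_mx w 0] and as [A22] on [col_mx 0 v]. *)
Lemma in_ctrlmx_block (R : realType) m k
    (A11 : 'M[R]_m) (A12 : 'M[R]_(m, k)) (A21 : 'M[R]_(k, m)) (A22 : 'M[R]_k)
    (v1 : 'cV[R]_m) (v2 : 'cV[R]_k) :
  in_image (ctrlmx (block_mx A11 A12 A21 A22) (col_mx 1%:M 0)) (col_mx v1 v2)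
  <-> in_image (ctrlmx A22 A21) v2.
Proof.
set A := block_mx _ _ _ _; set B := col_mx _ _.
have BE (w : 'cV[R]_m) : B *m w = col_mx w 0.
  by rewrite mul_col_mx mul1mx mul0mx.
have AE w (z : 'cV[R]_k) : A *m col_mx w z =
    col_mx (A11 *m w + A12 *m z) (A21 *m w + A22 *m z).
  exact: mul_block_col.
split=> [Iv|].
  rewrite -(col_mxKd v1 v2).
  elim/ctrl_ind: Iv => [|v w Iv Iw|w|v Iv].
  - by rewrite linear0; exact: in_image0.
  - by rewrite linearD; exact: in_imageD.
  - by rewrite BE col_mxKd; exact: in_image0.
  - rewrite -[v]vsubmxK AE col_mxKd; apply: in_imageD; first exact: in_ctrlmx_input.
    exact: in_ctrlmx_state.
have lift_input (w : 'cV[R]_m) (z : 'cV[R]_k) :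
    in_image (ctrlmx A B) (col_mx w z) -> in_image (ctrlmx A B) (col_mx 0 z).
  move=> Iz; have := in_imageD Iz (in_ctrlmx_input A B (- w)).
  by rewrite BE add_col_mx subrr addr0.
move=> Iv.
suff /in_imageD/(_ (in_ctrlmx_input A B v1)) :
    in_image (ctrlmx A B) (col_mx 0 v2).
  by rewrite BE add_col_mx addr0 add0r.
elim/ctrl_ind: Iv => [|v w Iv Iw|w|v Iv].
- by rewrite col_mx0; exact: in_image0.
- by rewrite -[0]addr0 -add_col_mx; exact: in_imageD.
- apply: (@lift_input (A11 *m w)).
  have := in_ctrlmx_state (in_ctrlmx_input A B w).
  by rewrite BE AE !mulmx0 !addr0.
- apply: (@lift_input (A12 *m v)).
  by have := in_ctrlmx_state Iv; rewrite AE !mulmx0 !add0r.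
Qed.

(** * Herdability in discrete time *)

(** Why one positive reachable vector is enough for every initial state and
    every threshold [h]: the free response [x] is outweighed by a large multiple
    of [v]. *)
Lemma exists_scale_ge (R : realType) p (x v : 'cV[R]_p) (h : R) :
  (forall i, 0 < v i 0) -> exists c : R, forall i, h <= x i 0 + c * v i 0.
Proof.
move=> v0; exists (\sum_i `|h - x i 0| / v i 0) => i.
rewrite -lerBlDl (le_trans (ler_norm _))// -ler_pdivrMr// (bigD1 i)//= lerDl.
by apply: sumr_ge0 => j _; rewrite divr_ge0// ltW.
Qed.

Lemma dt_trajectoryE (R : realType) p q (F : 'M[R]_p) (G : 'M[R]_(p, q)) tf u x :
  dt_trajectory F G tf u x ->
  forall t, (t <= tf)%N ->
  x t = F ^+ t *m x 0%N + \sum_(j < t) F ^+ j *m (G *m u (t - j.+1)%N).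
Proof.
move=> xE; elim=> [_|t IH tT]; first by rewrite big_ord0 expr0 mul1mx addr0.
rewrite xE// IH 1?ltnW// mulmxDr mulmxA -mx_exprS -addrA; congr (_ + _).
rewrite big_ord_recl expr0 mul1mx subn1 addrC mulmx_sumr; congr (_ + _).
by apply: eq_bigr => i _; rewrite mulmxA -mx_exprS lift0 subSS.
Qed.

(** Starting from 0 shows that positivity is necessary.  Conversely the free
    response after [p] steps is corrected by a multiple of the reachable vector;
    [p] steps give exactly the [p] blocks of the controllability matrix. *)
Lemma dt_herdableP (R : realType) p q (F : 'M[R]_p) (G : 'M[R]_(p, q)) :
  (0 < p)%N ->
  dt_herdable F G <->
  exists2 v, in_image (ctrlmx F G) v & forall i, 0 < v i 0.
Proof.
move=> p0; split=> [H|[v /in_ctrlmxP[w vE] v0] x0 h h0].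
  have [tf [u [x [_ xE x00 xh]]]] := H 0 1 ltr01.
  exists (x tf) => [|i]; last exact: lt_le_trans (xh i).
  rewrite (dt_trajectoryE xE)// x00 mulmx0 add0r; apply: in_image_sum => j _.
  exact: in_ctrlmx_exp.
have [c cP] := exists_scale_ge (F ^+ p *m x0) h v0.
(* The input at time t is propagated p - t - 1 times before time p. *)
pose u t := c *: oapp w 0 (insub (p - t.+1)%N).
pose x := fix x t := if t is s.+1 then F *m x s + G *m u s else x0.
exists p, u, x; split => // i.
have xE : dt_trajectory F G p u x by [].
rewrite (dt_trajectoryE xE)//= mxE; apply: le_trans (cP i) _.
rewrite lerD2l; have -> : c * v i 0 = (c *: v) i 0 by rewrite mxE.
rewrite vE scaler_sumr.
rewrite (eq_bigr (fun j : 'I_p => F ^+ j *m (G *m u (p - j.+1)%N))) // => j _.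
rewrite /u; have -> : (p - (p - j.+1).+1)%N = j by have := ltn_ord j; lia.
by rewrite valK /= -!scalemxAr.
Qed.

(** * Smooth trajectories *)

(** Trajectories on the whole real line with continuous inputs: the class in
    which steering is done.  It is stable under linear combinations and its
    members are trajectories in the integral sense by the fundamental theorem of
    calculus. *)
Definition smooth_trajectory (R : realType) p q (F : 'M[R]_p) (G : 'M[R]_(p, q))
    (u : R -> 'cV[R]_q) (x : R -> 'cV[R]_p) : Prop :=
  (forall j, continuous (fun s => u s j 0)) /\
  forall (t : R) i, is_derive t 1 (fun s => x s i 0) ((F *m x t + G *m u t) i 0).

Lemma is_derive1_continuous (R : realType) (f df : R -> R) :
  (forall t : R, is_derive t 1 f (df t)) -> continuous f.
Proof.
by move=> fE t; apply/differentiable_continuous/derivable1_diffP; case: (fE t).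
Qed.

Lemma continuous_mulmx (R : realType) (T : topologicalType) n p
    (L : 'M[R]_(n, p)) (x : T -> 'cV[R]_p) :
  (forall i, continuous (fun s => x s i 0)) ->
  forall i, continuous (fun s => (L *m x s) i 0).
Proof.
move=> xC i; have -> : (fun s => (L *m x s) i 0) =
    (fun s => \sum_(k < p) (L i k * x s k 0)).
  by apply/funext => s; rewrite mxE.
apply: continuous_big => [|k _ s]; first exact: add_continuous.
by apply: continuousM; [exact: cst_continuous|exact: xC].
Qed.

Section Smooth.
Context (R : realType) (p q : nat) (F : 'M[R]_p) (G : 'M[R]_(p, q)).

Lemma smooth_trajectory_ct u x tf : 0 < tf ->
  smooth_trajectory F G u x -> ct_trajectory F G tf u x.
Proof.
move=> tf0 [uC xE].
have xC i : continuous (fun s => x s i 0) by exact: is_derive1_continuous (xE^~ i).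
have fC i : continuous (fun s => (F *m x s + G *m u s) i 0).
  have -> : (fun s => (F *m x s + G *m u s) i 0) =
      (fun s => (F *m x s) i 0 + (G *m u s) i 0).
    by apply/funext => s; rewrite mxE.
  by move=> s; apply: continuousD; exact: continuous_mulmx.
have integrableC (f : R -> R) (t : R) : continuous f ->
    (@lebesgue_measure R).-integrable `[0, t[ (fun s => (f s)%:E).
  move=> cf; apply: (@integrableS _ _ _ (@lebesgue_measure R) `[0, t]) => //.
    exact: subset_itv_co_cc.
  apply: continuous_compact_integrable; first exact: segment_compact.
  exact: continuous_subspaceT.
split => [j|i|t /andP[t0 _] i].
- exact: integrableC.
- exact: continuous_subspaceT.
- move: t0; rewrite le_eqVlt => /predU1P[<-|t0].
    by rewrite set_itv_ge ?bnd_simp// Rintegral_set0 addr0.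
  rewrite Rintegral_itv_bndo_bndc; last exact: integrableC.
  rewrite /Rintegral (@continuous_FTC2 _ _ (fun s => x s i 0))//=.
  + by rewrite addrCA subrr addr0.
  + exact: continuous_subspaceT.
  + split.
    * by move=> s _; case: (xE s i).
    * exact/cvg_at_right_filter/xC.
    * exact/cvg_at_left_filter/xC.
  + by move=> s _; rewrite derive1E; case: (xE s i).
Qed.

Lemma smooth_trajectoryD u x v y :
  smooth_trajectory F G u x -> smooth_trajectory F G v y ->
  smooth_trajectory F G (fun t => u t + v t) (fun t => x t + y t).
Proof.
move=> [uC xE] [vC yE]; split=> [j|t i].
  have -> : (fun s => (u s + v s) j 0) = (fun s => u s j 0 + v s j 0).
    by apply/funext => s; rewrite mxE.
  by move=> s; apply: continuousD; [exact: uC|exact: vC].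
have -> : (fun s => (x s + y s) i 0) = (fun s => x s i 0) \+ (fun s => y s i 0).
  by apply/funext => s; rewrite mxE.
have := is_deriveD (xE t i) (yE t i).
suff -> : (F *m (x t + y t) + G *m (u t + v t)) i 0 =
  (F *m x t + G *m u t) i 0 + (F *m y t + G *m v t) i 0 by [].
by rewrite !mulmxDr addrACA [LHS]mxE.
Qed.

Lemma smooth_trajectoryZ c u x :
  smooth_trajectory F G u x ->
  smooth_trajectory F G (fun t => c *: u t) (fun t => c *: x t).
Proof.
move=> [uC xE]; split=> [j|t i].
  have -> : (fun s => (c *: u s) j 0) = (fun s => c * u s j 0).
    by apply/funext => s; rewrite mxE.
  by move=> s; apply: continuousM; [exact: cst_continuous|exact: uC].
have -> : (fun s => (c *: x s) i 0) = c \*: (fun s => x s i 0).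
  by apply/funext => s; rewrite mxE.
have := is_deriveZ c (xE t i).
suff -> : (F *m (c *: x t) + G *m (c *: u t)) i 0 =
  c *: (F *m x t + G *m u t) i 0 by [].
by rewrite -!scalemxAr -scalerDr [LHS]mxE.
Qed.

Lemma smooth_trajectory0 : smooth_trajectory F G (fun=> 0) (fun=> 0).
Proof.
split=> [j|t i]; first exact: cst_continuous.
by rewrite !mulmx0 addr0 mxE; exact: is_derive_cst.
Qed.

(** The horizon 1 is a normalisation: herdability leaves the final time free. *)
Definition steerable v := exists u x,
  [/\ smooth_trajectory F G u x, x 0 = 0 & x 1 = v].

Lemma steerable0 : steerable 0.
Proof. by exists (fun=> 0), (fun=> 0); split; first exact: smooth_trajectory0. Qed.

Lemma steerableD v w : steerable v -> steerable w -> steerable (v + w).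
Proof.
move=> [u [x [xE x0 <-]]] [u' [y [yE y0 <-]]].
exists (fun t => u t + u' t), (fun t => x t + y t).
by split=> //; [exact: smooth_trajectoryD|rewrite x0 y0 addr0].
Qed.

Lemma steerableZ c v : steerable v -> steerable (c *: v).
Proof.
move=> [u [x [xE x0 <-]]]; exists (fun t => c *: u t), (fun t => c *: x t).
by split=> //; [exact: smooth_trajectoryZ|rewrite x0 scaler0].
Qed.

Lemma steerable_sum (I : Type) (s : seq I) (P : pred I) (f : I -> 'cV[R]_p) :
  (forall i, P i -> steerable (f i)) -> steerable (\sum_(i <- s | P i) f i).
Proof.
by move=> Pf; apply: big_ind => //; [exact: steerable0|exact: steerableD].
Qed.
End Smooth.

(** * Polynomial steering *)

(** A derivation removes at most one factor [X - a], so only the [k]-th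
    derivative has lost them all; the Boolean factor treats the orders below [k]
    at the same time. *)
Lemma horner_derivn_XsubC_expM (R : comNzRingType) (a : R) (r : {poly R}) k l :
  (l <= k)%N ->
  ((('X - a%:P) ^+ k * r)^`(l)).[a] = (k`! * (l == k))%:R * r.[a].
Proof.
have dE (s : {poly R}) j : (('X - a%:P) * s)^`(j.+1) =
    ('X - a%:P) * s^`(j.+1) + s^`(j) *+ j.+1.
  elim: j => [|j IH]; first by rewrite derivn1 derivM derivXsubC mul1r derivn0 addrC.
  rewrite derivnS IH derivD derivM derivXsubC mul1r derivMn -!derivnS.
  by rewrite [in RHS]mulrS addrCA addrA.
elim: k l => [|k IH] [|l] // lk.
- by rewrite expr0 mul1r derivn0 fact0 mul1n eqxx mul1r.
- by rewrite derivn0 exprS -mulrA hornerM hornerXsubC subrr !mul0r muln0 mul0r.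
rewrite exprS -mulrA dE hornerD hornerM hornerXsubC subrr mul0r add0r.
rewrite hornerMn IH// eqSS factS -mulrnAl -mulrnA; congr (_%:R * _).
by have [->|] := eqVneq l k; lia.
Qed.

Lemma is_derive_poly_curve (R : realType) n (Q : nat -> {poly R})
    (g : nat -> 'cV[R]_n) N (t : R) i :
  is_derive t 1 (fun s => (\sum_(l < N) (Q l).[s] *: g l) i 0)
    ((\sum_(l < N) ((Q l)^`()).[t] *: g l) i 0).
Proof.
have E (P : nat -> {poly R}) s : (\sum_(l < N) (P l).[s] *: g l) i 0 =
    (\sum_(l < N) (g l i 0) *: P l).[s].
  rewrite summxE horner_sum; apply: eq_bigr => l _.
  by rewrite !mxE hornerZ mulrC.
rewrite (E (fun l => (Q l)^`())).
have -> : (fun s => (\sum_(l < N) (Q l).[s] *: g l) i 0) =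
    horner (\sum_(l < N) (g l i 0) *: Q l) by apply/funext => s; rewrite E.
have := is_derive_poly (\sum_(l < N) (g l i 0) *: Q l) t.
rewrite (_ : _^`() = \sum_(l < N) g l i 0 *: (Q l)^`())//.
by rewrite linear_sum; apply: eq_bigr => l _; exact: derivZ.
Qed.

Section Steering.
Context (R : realType) (p q : nat) (F : 'M[R]_p) (G : 'M[R]_(p, q)).

(** When [d] and [e] come from [horner_scheme], this is the trajectory
    [adj(d/dt - F) (psi G w)], with input [chi(d/dt) psi w] where [chi] is the
    characteristic polynomial of [F].  It solves the equation because the
    adjugate times [d/dt - F] is [chi(d/dt)]; with the Horner coefficients [e]
    of the adjugate this identity is a telescoping sum whose end terms are
    [e 0 = 1] and [e p = 0]. *)
Lemma flat_trajectory (d : nat -> R) (e : nat -> 'M[R]_p) (w : 'cV[R]_q)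
    (psi : {poly R}) :
  e 0%N = 1%:M -> (forall j, e j.+1 = F *m e j - (d j)%:M) -> e p = 0 ->
  smooth_trajectory F G
    (fun t => psi^`(p).[t] *: w - \sum_(l < p) psi^`(l).[t] *: (d (p - l.+1)%N *: w))
    (fun t => \sum_(l < p) psi^`(l).[t] *: (e (p - l.+1)%N *m (G *m w))).
Proof.
move=> e0 eS ep; split=> [j|t i].
  have -> : (fun s => (psi^`(p).[s] *: w -
      \sum_(l < p) psi^`(l).[s] *: (d (p - l.+1)%N *: w)) j 0) =
      horner (w j 0 *: psi^`(p) - \sum_(l < p) (d (p - l.+1)%N * w j 0) *: psi^`(l)).
    apply/funext => s; rewrite !mxE summxE hornerD hornerN hornerZ horner_sum.
    rewrite [w j 0 * _]mulrC; congr (_ - _); apply: eq_bigr => l _.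
    by rewrite !mxE hornerZ mulrC.
  exact: continuous_horner.
set g := fun l => e (p - l.+1)%N *m (G *m w).
suff -> : F *m (\sum_(l < p) psi^`(l).[t] *: g l) +
    G *m (psi^`(p).[t] *: w - \sum_(l < p) psi^`(l).[t] *: (d (p - l.+1)%N *: w)) =
    \sum_(l < p) (psi^`(l)^`()).[t] *: g l.
  exact: (is_derive_poly_curve (fun l => psi^`(l)) g p t i).
pose h l := psi^`(l).[t] *: (e (p - l)%N *m (G *m w)).
rewrite mulmxBr !mulmx_sumr addrCA -scalemxAr -sumrB.
rewrite [RHS](eq_bigr (fun l : 'I_p => h l.+1)); last first.
  by move=> l _; rewrite /h /g -derivnS.
transitivity (psi^`(p).[t] *: (G *m w) + \sum_(l < p) h l).
  congr (_ + _); apply: eq_bigr => l _; rewrite /h /g.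
  rewrite -!scalemxAr -scalerBr; congr (_ *: _).
  have -> : (p - l)%N = (p - l.+1).+1 by have := ltn_ord l; lia.
  by rewrite eS mulmxBl mul_scalar_mx !mulmxA.
have := telescope_sumr h (leq0n p); rewrite big_mkord sumrB.
rewrite {3}/h subnn e0 mul1mx {3}/h subn0 ep mul0mx scaler0 subr0.
by move=> <-; rewrite subrK.
Qed.

(** With [psi = X^p (X - 1)^m] and [m = p - 1 - k], all the derivatives of order
    less than [p] vanish at time 0, so the trajectory starts at 0, and those of
    order less than [m] vanish at time 1.  Its end point is thus
    [m! e_k G w] plus a combination of the [e_i G w] with [i < k], and all the
    [e_k G w] are reached by induction on [k].  The recurrence of the Horner
    coefficients then trades them for the [F^j G w]. *)
Lemma steerable_ctrl v : in_image (ctrlmx F G) v -> steerable F G v.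
Proof.
move=> /in_ctrlmxP[w ->]; apply: steerable_sum => j _; move: (w j) => {}w.
have [d [e [e0 eS ep]]] := horner_scheme F.
have Se k : (k < p)%N -> steerable F G (e k *m (G *m w)).
  elim/ltn_ind: k => k IH kp.
  pose m := (p - k.+1)%N.
  pose psi : {poly R} := 'X ^+ p * ('X - 1%:P) ^+ m.
  have : steerable F G (\sum_(l < p) psi^`(l).[1] *: (e (p - l.+1)%N *m (G *m w))).
    eexists; eexists; split; first exact: (flat_trajectory w psi e0 eS ep).
      apply: big1 => l _.
      have := @horner_derivn_XsubC_expM R 0 (('X - 1%:P) ^+ m) p l.
      rewrite polyC0 subr0 => -> //; last exact: ltnW.
      by rewrite ltn_eqF// muln0 mul0r scale0r.
    by [].
  have mp : (m < p)%N by rewrite /m; lia.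
  rewrite (bigD1 (Ordinal mp)) //=.
  have psiE l : (l <= m)%N -> psi^`(l).[1] = (m`! * (l == m))%:R.
    move=> lm; rewrite /psi mulrC horner_derivn_XsubC_expM//.
    by rewrite hornerXn expr1n mulr1.
  rewrite psiE// eqxx muln1.
  have -> : (p - m.+1)%N = k by rewrite /m; lia.
  set rest := \sum_(l < p | _) _ => Ssum.
  have Srest : steerable F G rest.
    apply: steerable_sum => l lm.
    have [lm'|ml] := ltnP l m.
      by rewrite psiE 1?ltnW// ltn_eqF// muln0 scale0r; exact: steerable0.
    have {}ml : (m < l)%N.
      by rewrite ltn_neqAle ml andbT eq_sym; exact: lm.
    by apply/steerableZ/IH; move: ml; have := ltn_ord l; rewrite /m; lia.
  have := steerableD Ssum (steerableZ (-1) Srest).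
  rewrite scaleN1r addrK => /(steerableZ (m`!%:R)^-1).
  by rewrite scalerA mulVf ?scale1r// pnatr_eq0 -lt0n fact_gt0.
(* The case k = 0 is the claim; a larger k makes the induction on i go
   through, as F e_k is e_(k+1) up to a multiple of e_0. *)
suff H i k : (i + k < p)%N -> steerable F G (F ^+ i *m (e k *m (G *m w))).
  have := H j 0%N; rewrite addn0 e0 mul1mx; exact.
elim: i k => [|i IH] k ikp; first by rewrite expr0 mul1mx; exact: Se.
have -> : F ^+ i.+1 *m (e k *m (G *m w)) =
    F ^+ i *m (e k.+1 *m (G *m w)) + d k *: (F ^+ i *m (e 0%N *m (G *m w))).
  rewrite eS e0 mul1mx mulmxBl mul_scalar_mx mulmxBr -scalemxAr subrK.
  by rewrite mx_exprSr !mulmxA.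
apply: steerableD; first by apply: IH; lia.
by apply/steerableZ/IH; lia.
Qed.
End Steering.

(** * Linear flows: existence and uniqueness *)

Section Flow.
Context (R : realType) (p : nat) (F : 'M[R]_p).

(** The coefficients of the power series of the entry [i] of [exp(tF) y]. *)
Definition flow_coef (y : 'cV[R]_p) (i : 'I_p) (n : nat) : R :=
  (F ^+ n *m y) i 0 / n`!%:R.

(** A crude bound in the 1-norm, enough to compare the series of [exp(tF) y]
    with a scalar exponential series. *)
Lemma expmx_col_bound (y : 'cV[R]_p) n :
  \sum_i `|(F ^+ n *m y) i 0| <= (\sum_i \sum_j `|F i j|) ^+ n * \sum_i `|y i 0|.
Proof.
set K := \sum_i _; have K0 : 0 <= K by do 2 (apply: sumr_ge0 => ? _).
elim: n => [|n IH]; first by rewrite !expr0 mul1mx mul1r.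
rewrite [K ^+ _]exprS -mulrA; apply: le_trans (ler_wpM2l K0 IH).
rewrite mulr_suml ler_sum// => i _.
rewrite mx_exprS -mulmxA mxE (le_trans (ler_norm_sum _ _ _))//.
rewrite mulr_suml ler_sum// => j _; rewrite normrM ler_wpM2l//.
by rewrite (bigD1 j)//= lerDl sumr_ge0.
Qed.

Lemma is_cvg_flow_coef y i t : cvgn (pseries (flow_coef y i) t).
Proof.
set K := \sum_i \sum_j `|F i j|; have K0 : 0 <= K by do 2 (apply: sumr_ge0 => ? _).
set C := \sum_i `|y i 0|; have C0 : 0 <= C by apply: sumr_ge0.
apply: normed_cvg.
apply: (@series_le_cvg _ _ (C *: exp_coeff (K * `|t|))) => [n|n|n|].
- exact: normr_ge0.
- by apply: mulr_ge0 => //; apply: exp_coeff_ge0; rewrite mulr_ge0.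
- rewrite /= /flow_coef normrM normrX normrM normfV (ger0_norm (ler0n _ _)).
  have -> : (C *: exp_coeff (K * `|t|)) n = K ^+ n * C / n`!%:R * `|t| ^+ n.
    by rewrite -[LHS]/(C * ((K * `|t|) ^+ n / n`!%:R)) exprMn; ring.
  rewrite ler_wpM2r ?exprn_ge0// ler_wpM2r ?invr_ge0//.
  apply: le_trans (expmx_col_bound y n).
  by rewrite (bigD1 i)//= lerDl sumr_ge0.
- by apply: is_cvg_seriesZ; exact: is_cvg_series_exp_coeff.
Qed.

(** Term by term differentiation replaces [y] by [F y]: this is the
    differential equation at the level of the series. *)
Lemma flow_coef_diffs y i :
  pseries_diffs (flow_coef y i) = flow_coef (F *m y) i.
Proof.
apply/funext => n; rewrite /pseries_diffs /flow_coef factS natrM invfM.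
by rewrite mx_exprSr -mulmxA mulrCA mulVKf.
Qed.

Lemma linear_flow_exists (x0 : 'cV[R]_p) :
  exists2 x : R -> 'cV[R]_p, x 0 = x0 &
    forall (t : R) i, is_derive t 1 (fun s => x s i 0) ((F *m x t) i 0).
Proof.
pose x y t : 'cV[R]_p := \col_i limn (pseries (flow_coef y i) t).
exists (x x0) => [|t i].
  apply/matrixP => i j; rewrite ord1 mxE; apply: lim_near_cst => //.
  near=> m; rewrite /pseries /series /= -[m]prednK; last by near: m.
  rewrite big_nat_recl// expr0 mulr1 big1 ?addr0 => [|k _].
    by rewrite /flow_coef expr0 mul1mx fact0 divr1.
  by rewrite exprS mul0r mulr0.
have -> : (fun s => x x0 s i 0) = (fun s => limn (pseries (flow_coef x0 i) s)).
  by apply/funext => s; rewrite mxE.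
have -> : (F *m x x0 t) i 0 = limn (pseries (pseries_diffs (flow_coef x0 i)) t).
  rewrite flow_coef_diffs mxE; apply/esym/cvg_lim => //.
  have -> : pseries (flow_coef (F *m x0) i) t =
      (fun n => \sum_(k < p) F i k * pseries (flow_coef x0 k) t n).
    apply/funext => n; rewrite /pseries /series /=.
    under [RHS]eq_bigr do rewrite mulr_sumr.
    rewrite exchange_big; apply: eq_bigr => j _ /=.
    rewrite /flow_coef mulmxA -mx_exprSr mx_exprS -mulmxA mxE !mulr_suml.
    by apply: eq_bigr => k _; rewrite !mulrA.
  apply: cvg_big => [|k _]; first exact: add_continuous.
  by rewrite mxE; apply: cvgMl_tmp; exact: is_cvg_flow_coef.
apply: (@pseries_snd_diffs _ _ (`|t| + 1)); rewrite ?flow_coef_diffs.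
- exact: is_cvg_flow_coef.
- exact: is_cvg_flow_coef.
- exact: is_cvg_flow_coef.
- by rewrite [ltRHS]ger0_norm// ltrDl.
Unshelve. all: by end_near. Qed.

(** An integral curve of a continuous function is differentiable in the
    interior, although the equation only holds on a compact interval. *)
Lemma integral_is_derive (f g : R -> R) (T t : R) :
  {within `[0, T], continuous f} ->
  (forall s, 0 <= s <= T ->
     g s = Rintegral (@lebesgue_measure R) `[0, s[ f) ->
  0 < t < T -> is_derive t 1 g (f t).
Proof.
move=> fC gE /andP[t0 tT]; have T0 := lt_trans t0 tT.
have fI : (@lebesgue_measure R).-integrable `[0, T] (EFin \o f).
  by apply: continuous_compact_integrable => //; exact: segment_compact.
have ft : {for t, continuous f}.
  have /(continuous_within_itvP _ T0)[+ _ _] := fC.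
  by apply; rewrite in_itv/= t0 tT.
have [dF F'] := @continuous_FTC1_closed R f 0 t T tT fI t0 ft.
apply: (@near_eq_is_derive _ _ _
  (fun s : R => Rintegral (@lebesgue_measure R) `[0, s] f : R)); last first.
  by apply: DeriveDef => //; rewrite -derive1E.
near=> s.
have s0 : 0 <= s by apply: ltW; near: s; exact: lt_nbhsr.
have sT : s <= T by near: s; exact: lt_le_nbhsl.
rewrite gE ?s0// Rintegral_itv_bndo_bndc//.
apply: (integrableS _ _ _ fI) => //.
by apply: subset_itvScc; rewrite ?bnd_simp.
Unshelve. all: by end_near. Qed.

End Flow.

(** Adjoint argument.  Let [w] solve [w' = F^T w] with [w 0] the [i]-th basis
    vector.  The pairing of [w (T - t)] with [y t] has zero derivative, vanishes
    at time 0 since [y 0 = 0], and equals the [i]-th entry of [y T] at time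
    [T]. *)
Lemma linear_flow_unique (R : realType) p (F : 'M[R]_p) (y : R -> 'cV[R]_p)
    (T : R) : 0 < T ->
  (forall i, {within `[0, T], continuous (fun s => y s i 0)}) ->
  (forall t, 0 <= t <= T -> forall i,
     y t i 0 = Rintegral (@lebesgue_measure R) `[0, t[
                 (fun s => (F *m y s) i 0)) ->
  y T = 0.
Proof.
move=> T0 yC yE; apply/matrixP => i j; rewrite ord1 [RHS]mxE.
have [w w0 wE] := linear_flow_exists F^T (delta_mx i 0).
pose wT k (s : R) := w (T - s) k 0.
pose phi := fun t : R => \sum_(k < p) wT k t * y t k 0.
have y0 k : y 0 k 0 = 0.
  by rewrite yE ?lexx ?ltW// set_itv_ge ?bnd_simp// Rintegral_set0.
have yD (t : R) k : 0 < t < T ->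
    is_derive t 1 (fun s => y s k 0) ((F *m y t) k 0).
  apply: (@integral_is_derive R (fun s => (F *m y s) k 0)).
    exact: (@continuous_mulmx R (subspace `[0, T])).
  by move=> s sT; exact: yE.
have wD (t : R) k : is_derive t 1 (wT k) (- (F^T *m w (T - t)) k 0).
  have dT : is_derive t 1 (fun s : R => T - s) (-1).
    have := is_deriveB (is_derive_cst T t 1) (is_derive_id t (1 : R)).
    by rewrite sub0r.
  have := @is_derive1_comp R (fun s => w s k 0) _ t _ _ (wE (T - t) k) dT.
  by rewrite mulrN1.
have phiD (t : R) : t \in `]0, T[%R -> is_derive t 1 phi 0.
  rewrite in_itv/= => tT.
  have -> : phi = \sum_(k < p) (wT k * (fun s => y s k 0)).
    by apply/funext => s; rewrite fct_sumE.
  have := is_derive_sum (fun k => is_deriveM (wD t k) (yD t k tT)).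
  rewrite big_split /= => dphi.
  apply: is_derive_eq dphi _.
  apply/eqP; rewrite addr_eq0 -sumrN; apply/eqP.
  transitivity (\sum_k \sum_l w (T - t) k 0 * F k l * y t l 0).
    apply: eq_bigr => k _; rewrite mxE scaler_sumr; apply: eq_bigr => l _.
    by rewrite -[LHS]/(w (T - t) k 0 * (F k l * y t l 0)) mulrA.
  rewrite exchange_big; apply: eq_bigr => l _ /=.
  rewrite scalerN opprK mxE scaler_sumr; apply: eq_bigr => k _.
  by rewrite mxE -[RHS]/(y t l 0 * (F k l * w (T - t) k 0)); ring.
have phiC : {within `[0, T], continuous phi}.
  apply: (@continuous_big _ _ _ _ _ _ (subspace `[0, T])) => [|k _].
    exact: add_continuous.
  move=> s; apply: continuousM; last exact: yC.
  by apply: continuous_subspaceT; exact: is_derive1_continuous (wD^~ k).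
have [c _] := MVT_segment (ltW T0) phiD phiC.
rewrite mul0r /phi [X in _ - X]big1 ?subr0 => [|k _]; last by rewrite y0 mulr0.
rewrite (bigD1 i)//= big1 => [|k ki].
  by rewrite /wT subrr w0 mxE !eqxx mul1r addr0.
by rewrite /wT subrr w0 mxE (negbTE ki) mul0r.
Qed.

(** * Herdability in continuous time *)

Lemma integrable_mulmx d (T : measurableType d) (R : realType)
    (mu : {measure set T -> \bar R}) n p (L : 'M[R]_(n, p)) (D : set T)
    (g : T -> 'cV[R]_p) i :
  measurable D ->
  (forall k, mu.-integrable D (fun s => (g s k 0)%:E)) ->
  mu.-integrable D (fun s => ((L *m g s) i 0)%:E) /\
  Rintegral mu D (fun s => (L *m g s) i 0) =
  \sum_k L i k * Rintegral mu D (fun s => g s k 0).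
Proof.
move=> mD gI.
have -> : (fun s => (L *m g s) i 0) = (fun s => \sum_k L i k * g s k 0).
  by apply/funext => s; rewrite mxE.
have -> : (fun s => ((L *m g s) i 0)%:E) = (fun s => (\sum_k L i k * g s k 0)%:E).
  by apply/funext => s; rewrite mxE.
elim: (index_enum _) => [|k r [IHi IHe]].
  rewrite big_nil; split.
    by under eq_fun do rewrite big_nil; exact: integrable0.
  by under eq_Rintegral do rewrite big_nil; rewrite Rintegral_cst// mul0r.
have kI : mu.-integrable D (fun s => (L i k * g s k 0)%:E).
  by under eq_fun do rewrite EFinM; exact: integrableZl.
split.
  by under eq_fun do rewrite big_cons EFinD; exact: integrableD.
under eq_Rintegral do rewrite big_cons.
rewrite (RintegralD mD kI IHi) big_cons; congr (_ + _); last exact: IHe.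
exact: (@RintegralZl _ _ _ mu D (fun s => g s k 0) (L i k) mD (gI k)).
Qed.

Lemma mulmx_cV_eq0 (R : pzSemiRingType) m n (M : 'M[R]_(m, n)) :
  (forall w : 'cV[R]_n, M *m w = 0) -> M = 0.
Proof.
move=> M0; apply/matrixP => i j.
by have /matrixP/(_ i 0) := M0 (delta_mx j 0); rewrite -colE !mxE.
Qed.

Section Reach.
Context (R : realType) (p q : nat) (F : 'M[R]_p) (G : 'M[R]_(p, q)).

(** The forms that annihilate an invariant subspace are stable under right
    multiplication by [F], so they evolve by themselves, with matrix [D]. *)
Lemma annihilator_state :
  exists D, kermx (ctrlmx F G) *m F = D *m kermx (ctrlmx F G).
Proof.
apply/submxP/sub_kermxP/mulmx_cV_eq0 => w.
have -> : kermx (ctrlmx F G) *m F *m ctrlmx F G *m w =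
    kermx (ctrlmx F G) *m (F *m (ctrlmx F G *m w)) by rewrite !mulmxA.
apply/in_image_kermx/in_ctrlmx_state.
by exists w.
Qed.

Lemma annihilator_input : kermx (ctrlmx F G) *m G = 0.
Proof.
apply/mulmx_cV_eq0 => w; rewrite -(mulmxA (kermx _)).
exact/in_image_kermx/in_ctrlmx_input.
Qed.

(** Apply the annihilating forms [L] of the reachable subspace to the state.
    Since [L G = 0] and [L F = D L], the curve [L x] satisfies the homogeneous
    equation with matrix [D] from 0; the input, which is merely integrable, has
    disappeared, so [L x] is differentiable and uniqueness applies. *)
Lemma ct_reach_ctrl tf u x : 0 < tf ->
  ct_trajectory F G tf u x -> x 0 = 0 -> in_image (ctrlmx F G) (x tf).
Proof.
move=> tf0 [uI xC xE] x0; apply/in_image_kermx.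
have [D] := annihilator_state; have := annihilator_input.
move: (kermx _) => L LG LF.
apply: (@linear_flow_unique R p D (fun t => L *m x t) tf tf0) => [i|t tT i].
  exact: (@continuous_mulmx R (subspace `[0, tf])).
have /andP[t0 tf'] := tT.
have FI k : (@lebesgue_measure R).-integrable `[0, t[ (fun s => ((F *m x s) k 0)%:E).
  apply: (integrable_mulmx _ _ _ _).1 => // l.
  apply: (@integrableS _ _ _ (@lebesgue_measure R) `[0, tf]) => //.
    by apply: subset_itvScc; rewrite bnd_simp.
  by apply: continuous_compact_integrable; [exact: segment_compact|exact: xC].
have GI k : (@lebesgue_measure R).-integrable `[0, t[ (fun s => ((G *m u s) k 0)%:E).
  apply: (integrable_mulmx _ _ _ _).1 => // l.
  apply: (@integrableS _ _ _ (@lebesgue_measure R) `[0, tf[) => //.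
  by apply: subset_itvl; rewrite bnd_simp.
have fI k : (@lebesgue_measure R).-integrable `[0, t[
    (fun s => ((F *m x s + G *m u s) k 0)%:E).
  have -> : (fun s => ((F *m x s + G *m u s) k 0)%:E) =
      (fun s => ((F *m x s) k 0)%:E + ((G *m u s) k 0)%:E)%E.
    by apply/funext => s; rewrite mxE EFinD.
  exact: integrableD.
rewrite mxE (eq_bigr (fun k => L i k * Rintegral (@lebesgue_measure R) `[0, t[
    (fun s => (F *m x s + G *m u s) k 0))); last first.
  by move=> k _; rewrite xE// x0 mxE add0r.
rewrite -(integrable_mulmx _ _ _ _).2//; apply: eq_Rintegral => s _.
by rewrite mulmxDr !mulmxA -LF LG mul0mx addr0.
Qed.

(** As in discrete time: the free response [exp(tF) x0] at time 1 is corrected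
    by a multiple of a trajectory that steers 0 to the positive vector. *)
Lemma ct_herdableP :
  ct_herdable F G <->
  exists2 v, in_image (ctrlmx F G) v & forall i, 0 < v i 0.
Proof.
split=> [H|[v Iv v0] x0 h h0].
  have [tf [u [x [tf0 xE x00 xh]]]] := H 0 1 ltr01.
  exists (x tf) => [|i]; last exact: lt_le_trans (xh i).
  exact: ct_reach_ctrl xE x00.
have [y y0 yE] := linear_flow_exists F x0.
have [u [z [zE z0 z1]]] := steerable_ctrl Iv.
have [c cP] := exists_scale_ge (y 1) h v0.
have yS : smooth_trajectory F G (fun=> 0) y.
  split=> [j|t i]; first exact: cst_continuous.
  by rewrite mulmx0 addr0; exact: yE.
exists 1, (fun t => 0 + c *: u t), (fun t => y t + c *: z t); split=> //.
- apply: smooth_trajectory_ct => //.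
  by apply: smooth_trajectoryD => //; exact: smooth_trajectoryZ.
- by rewrite y0 z0 scaler0 addr0.
- by move=> i; rewrite z1 !mxE; exact: cP.
Qed.
End Reach.

(** * The reduction *)

Theorem proposition7 (R : realType) (m k : nat) (hm : (0 < m)%N) (hk : (0 < k)%N)
    (A : 'M[R]_(m + k)) (B : 'M[R]_(m + k, m))
    (A11 : 'M[R]_m) (A12 : 'M[R]_(m, k)) (A21 : 'M[R]_(k, m)) (A22 : 'M[R]_k)
    (hA : A = block_mx A11 A12 A21 A22) (hB : B = col_mx 1%:M 0) :
  [/\ forall (v1 : 'cV[R]_m) (v2 : 'cV[R]_k),
        in_image (ctrlmx A B) (col_mx v1 v2) <-> in_image (ctrlmx A22 A21) v2,
      ct_herdable A B <-> ct_herdable A22 A21 &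
      dt_herdable A B <-> dt_herdable A22 A21].
Proof.
have block v1 v2 : in_image (ctrlmx A B) (col_mx v1 v2) <->
    in_image (ctrlmx A22 A21) v2 by rewrite hA hB; exact: in_ctrlmx_block.
have positive :
    (exists2 v, in_image (ctrlmx A B) v & forall i, 0 < v i 0) <->
    (exists2 v, in_image (ctrlmx A22 A21) v & forall i, 0 < v i 0).
  split=> [[v Iv v0]|[v2 Iv2 v20]].
    exists (dsubmx v) => [|i]; last by rewrite mxE.
    by apply/(block (usubmx v)); rewrite vsubmxK.
  (* The upper block is unconstrained, so any positive vector will do. *)
  exists (col_mx (const_mx 1) v2) => [|i]; first exact/block.
  by rewrite mxE; case: splitP => j _; rewrite ?mxE.
split=> //.
  by split=> /ct_herdableP/positive/ct_herdableP.
have mk : (0 < m + k)%N by rewrite addn_gt0 hm.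
by split=> /dt_herdableP H; apply/dt_herdableP => //; apply/positive/H.
Qed.
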